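(* Let $G=(V,E)$ be an undirected connected graph, and let $S\subset V$ with $|S|=2$. Then $S$ is a minimal perfect critical $2$ vertex set of $G$ if and only if for every $v\in\overline{S}=V\setminus S$, either $N_S(v)=\emptyset$ or $N_S(v)=S$.
   Context: Graphs are finite, simple, undirected, unweighted. $\mathbf{L}$ denotes the Laplacian matrix of $G$ (degree matrix minus adjacency matrix). For $S\subset V$, $\overline{S}=V\setminus S$ and $N_S(v)=\{u\in S: uv\in E\}$. For a vector $\mathbf{y}$ indexed by $V$, $\mathbf{y}|_S$ is the restriction of $\mathbf{y}$ to the coordinates in $S$. A nonempty $S\subset V$ is a critical vertex set if there is an eigenvector $\mathbf{y}$ of $\mathbf{L}$ with $\mathbf{y}|_{\overline S}=\mathbf{0}$. It is a perfect critical vertex set if there is an eigenvector $\mathbf{y}$ of $\mathbf{L}$ with $\mathbf{y}|_{\overline S}=\mathbf{0}$ and $\mathbf{y}|_{\{v\}}\neq 0$ for every $v\in S$. ($S=V$ is allowed.) A perfect critical vertex set is minimal if no proper subset of it is a perfect critical vertex set. A minimal perfect critical $k$ vertex set is a minimal perfect critical vertex set of cardinality $k$. *)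

(* Defs.v *)
From HB Require Import structures.
From mathcomp Require Import all_boot all_order all_algebra reals.
Set Implicit Arguments.
Unset Strict Implicit.
Unset Printing Implicit Defensive.
Import GRing.Theory.
Local Open Scope ring_scope.

Record sgraph := SGraph {
  vertex :> finType;
  adj : rel vertex;
  adj_sym : symmetric adj;
  adj_irrefl : irreflexive adj }.

Definition connected_graph (G : sgraph) : Prop :=
  forall u v : G, connect (@adj G) u v.

Definition nbrs (G : sgraph) (S : {set G}) (v : G) : {set G} :=
  [set u in S | adj u v].

Definition degree (G : sgraph) (v : G) : nat := #|nbrs [set: G] v|.

(* Rows and columns are indexed by 'I_#|G|; the vertex attached to an index i
   is enum_val i, and the index of a vertex v is enum_rank v. *)
Definition degree_mx (R : realType) (G : sgraph) : 'M[R]_#|G| :=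
  diag_mx (\row_i (degree (enum_val i))%:R).

Definition adjacency_mx (R : realType) (G : sgraph) : 'M[R]_#|G| :=
  \matrix_(i, j) (adj (enum_val i) (enum_val j))%:R.

Definition laplacian (R : realType) (G : sgraph) : 'M[R]_#|G| :=
  degree_mx R G - adjacency_mx R G.

Definition eigenvector (R : realType) (n : nat) (A : 'M[R]_n) (y : 'cV[R]_n)
  : Prop :=
  y != 0 /\ exists a : R, A *m y = a *: y.

Definition entry (R : realType) (G : sgraph) (y : 'cV[R]_#|G|) (v : G) : R :=
  y (enum_rank v) 0.

Definition vanishes_on (R : realType) (G : sgraph) (y : 'cV[R]_#|G|)
  (S : {set G}) : Prop :=
  forall v : G, v \in S -> entry y v = 0.

Definition perfect_critical (R : realType) (G : sgraph) (S : {set G}) : Prop :=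
  S != set0 /\
  exists y : 'cV[R]_#|G|,
    [/\ eigenvector (laplacian R G) y,
        vanishes_on y (~: S)
      & forall v : G, v \in S -> entry y v != 0].

Definition minimal_perfect_critical (R : realType) (G : sgraph) (S : {set G})
  : Prop :=
  perfect_critical R S /\
  forall S' : {set G}, S' \proper S -> ~ perfect_critical R S'.

Definition minimal_perfect_critical_k (R : realType) (G : sgraph) (k : nat)
  (S : {set G}) : Prop :=
  minimal_perfect_critical R S /\ #|S| = k.

(* Main.v *)
Require Import Defs.
From mathcomp Require Import all_boot all_order all_algebra reals.

Set Implicit Arguments.
Unset Strict Implicit.
Unset Printing Implicit Defensive.
Import GRing.Theory.
Local Open Scope ring_scope.

(** Evaluated at a vertex v outside S, the eigenvalue equation for a vector y
    supported on S says that the sum of y over N_S(v) is 0.  If y has no zero on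
    S, then N_S(v) is not a singleton; applied to a singleton S this also shows
    that no singleton is perfect critical in a connected graph with at least two
    vertices.  Conversely, when a and b have the same neighbours outside
    S = {a, b}, they have equal degrees and e_a - e_b is an eigenvector with
    eigenvalue deg a + [a ~ b]. *)

Lemma degree_sum (G : sgraph) (v : G) : degree v = (\sum_u adj v u)%N.
Proof.
rewrite /degree -sum1_card big_mkcond /=; apply: eq_bigr => u _.
by rewrite !inE /= adj_sym; case: (adj v u).
Qed.

Lemma entry_ext (R : realType) (G : sgraph) (x y : 'cV[R]_#|G|) :
  (forall v : G, entry x v = entry y v) -> x = y.
Proof.
move=> exy; apply/matrixP => i j; rewrite ord1.
by have := exy (enum_val i); rewrite /entry enum_valK.
Qed.

(** Trades the ordinal indices of the matrix for vertices, by reindexing along [enum_rank]. *)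
Lemma entry_laplacian (R : realType) (G : sgraph) (y : 'cV[R]_#|G|) (v : G) :
  entry (laplacian R G *m y) v =
  (degree v)%:R * entry y v - \sum_u (adj v u)%:R * entry y u.
Proof.
rewrite /entry mulmxBl mul_diag_mx !mxE enum_rankK; congr (_ - _).
rewrite (reindex (@enum_rank G)) /=; last first.
  by exists enum_val => u _; rewrite ?enum_rankK ?enum_valK.
by apply: eq_bigr => u _; rewrite !mxE !enum_rankK.
Qed.

Lemma perfect_critical_sum (R : realType) (G : sgraph) (S : {set G}) :
  perfect_critical R S ->
  exists y : 'cV[R]_#|G|,
    (forall u, u \in S -> entry y u != 0) /\
    (forall v, v \notin S -> \sum_(u in S) (adj v u)%:R * entry y u = 0).
Proof.
move=> [_ [y [[_ [a Ly]] y0 yS]]]; exists y; split=> // v vS.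
have := entry_laplacian y v.
rewrite Ly {1}/entry mxE -/(entry y v) (y0 v) ?inE // !mulr0 sub0r.
move=> /esym /eqP; rewrite oppr_eq0 => /eqP sum0.
(* Since [entry y v] is 0, only the neighbour sum survives in row [v], whatever the eigenvalue; its
   terms outside [S] vanish too. *)
rewrite -[RHS]sum0 [RHS](bigID (mem S)) /= [X in _ + X]big1 ?addr0 // => u uS.
by rewrite (y0 u) ?inE // mulr0.
Qed.

Lemma connected_neighbour (G : sgraph) (a b : G) :
  connected_graph G -> a != b -> exists c, adj a c.
Proof.
move=> /(_ a b) /connectP [[|c p] /= pth ->]; first by rewrite eqxx.
by move=> _; exists c; case/andP: pth.
Qed.

Lemma not_perfect_critical1 (R : realType) (G : sgraph) (a b : G) :
  connected_graph G -> a != b -> ~ perfect_critical R [set a].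
Proof.
move=> Gc ab /perfect_critical_sum [y [ya y0]].
have [c ac] := connected_neighbour Gc ab.
have /y0 : c \notin [set a].
  by rewrite inE; apply: contraTneq ac => ->; rewrite adj_irrefl.
rewrite big_set1 adj_sym ac mul1r => /eqP.
by apply/negP/ya; rewrite inE.
Qed.

(** Split off the terms at [a] and [b] from both degree sums: the diagonal ones are 0, the cross
    ones agree by symmetry, and the rest agree termwise. *)
Lemma twin_degree (G : sgraph) (a b : G) :
  (forall v, v \notin [set a; b] -> adj v a = adj v b) ->
  degree a = degree b.
Proof.
move=> twin; have [-> //|ab] := eqVneq a b.
rewrite !degree_sum (bigD1 a) //= (bigD1 b) 1?eq_sym //=.
rewrite [RHS](bigD1 a) //= [in RHS](bigD1 b) 1?eq_sym //=.
rewrite !adj_irrefl (adj_sym b a) addnA [RHS]addnA addn0 add0n; congr addn.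
apply: eq_bigr => u uab.
by rewrite adj_sym twin 1?adj_sym // !inE negb_or.
Qed.

Lemma twin_perfect_critical (R : realType) (G : sgraph) (a b : G) :
  a != b -> (forall v, v \notin [set a; b] -> adj v a = adj v b) ->
  perfect_critical R [set a; b].
Proof.
move=> ab twin; split; first by apply/set0Pn; exists a; rewrite !inE eqxx.
pose y : 'cV[R]_#|G| :=
  \col_i ((enum_val i == a)%:R - (enum_val i == b)%:R).
have yE v : entry y v = (v == a)%:R - (v == b)%:R.
  by rewrite /entry mxE enum_rankK.
have ya : entry y a = 1 by rewrite yE eqxx (negbTE ab) subr0.
have yb : entry y b = -1 by rewrite yE eqxx eq_sym (negbTE ab) sub0r.
have sum1 v w : \sum_u (adj v u)%:R * (u == w)%:R = (adj v w)%:R :> R.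
  rewrite (bigD1 w) //= eqxx mulr1 big1 ?addr0 // => u /negbTE ->.
  by rewrite mulr0.
exists y; split.
- split.
    apply: contraTneq (oner_neq0 R) => y0.
    by rewrite -ya y0 /entry mxE eqxx.
  (* Row [a] forces this eigenvalue; row [b] gives its negative because the degrees agree, and in
     every other row the two neighbour terms cancel. *)
  exists ((degree a)%:R + (adj a b)%:R); apply: entry_ext => v.
  rewrite entry_laplacian [RHS]/entry mxE -/(entry y v).
  under eq_bigr do rewrite yE mulrBr.
  rewrite sumrB !sum1.
  have [->|va] := eqVneq v a; first by rewrite ya adj_irrefl sub0r opprK !mulr1.
  have [->|vb] := eqVneq v b.
    by rewrite yb adj_irrefl subr0 (twin_degree twin) adj_sym !mulrN1 opprD.
  rewrite twin ?inE ?negb_or ?va ?vb // yE (negbTE va) (negbTE vb).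
  by rewrite !subrr !mulr0 subr0.
- move=> v; rewrite !inE negb_or => /andP [/negbTE va /negbTE vb].
  by rewrite yE va vb subrr.
- move=> v; rewrite !inE => /orP [] /eqP ->; first by rewrite ya oner_eq0.
  by rewrite yb oppr_eq0 oner_eq0.
Qed.

Local Close Scope ring_scope.

Theorem theorem1 (R : realType) (G : sgraph) (S : {set G}) :
  connected_graph G -> #|S| = 2 ->
  (minimal_perfect_critical_k R 2 S <->
   forall v : G, v \in ~: S -> nbrs S v = set0 \/ nbrs S v = S).
Proof.
move=> Gc S2; have /eqP/cards2P [a [b [ab defS]]] := S2.
have aS : a \in S by rewrite defS !inE eqxx.
have bS : b \in S by rewrite defS !inE eqxx orbT.
split=> [[[pcS _] _] v | nbrsS].
  have [y [yS y0]] := perfect_critical_sum pcS.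
  rewrite inE => /y0; rewrite defS big_setU1 ?inE // big_set1 /=.
  have eqN (N : {set G}) : (a \in N) = adj v a -> (b \in N) = adj v b ->
      N \subset [set a; b] -> nbrs [set a; b] v = N.
    move=> Na Nb /subsetP NS; apply/setP => u.
    have [uab|uab] := boolP (u \in [set a; b]); last first.
      by rewrite inE (negbTE uab); apply/esym/negbTE; apply: contra uab => /NS.
    rewrite inE uab /= adj_sym.
    by case/set2P: uab => ->.
  (* If [v] is adjacent to exactly one of [a] and [b], the zero sum is a single nonzero entry of
     [y], a contradiction. *)
  case va: (adj v a); case vb: (adj v b) => /eqP.
  - by move=> _; right; apply: eqN; rewrite ?va ?vb // !inE eqxx ?orbT.
  - by rewrite mul0r addr0 mul1r (negbTE (yS a aS)).
  - by rewrite mul0r add0r mul1r (negbTE (yS b bS)).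
  - by move=> _; left; apply: eqN; rewrite ?va ?vb ?inE // sub0set.
split=> //; split.
  rewrite defS; apply: twin_perfect_critical => // v; rewrite -defS => vS.
  have nbrsE u : u \in S -> adj v u = (u \in nbrs S v).
    by move=> uS; rewrite inE uS adj_sym.
  rewrite !nbrsE //.
  have vC : v \in ~: S by rewrite inE.
  (* Neither the empty set nor [S] separates [a] from [b]. *)
  by case: (nbrsS v vC) => ->; rewrite ?inE // aS bS.
move=> S' S'S pcS'; have [S'0 _] := pcS'.
have /eqP/cards1P [c defS'] : #|S'| = 1%N.
  have := proper_card S'S; move: S'0; rewrite S2 -card_gt0.
  by case: #|S'| => [|[]].
rewrite defS' in pcS'.
(* Excluding the singleton of [c] takes a second vertex: [b] if [c] is [a], and [a] otherwise. *)
have [ca|ca] := eqVneq c a.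
  by apply: (not_perfect_critical1 (b := b) Gc _ pcS'); rewrite ca.
exact: (not_perfect_critical1 Gc ca pcS').
Qed.
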